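(* Let $X_1,X_2,\ldots$ be i.i.d. Poisson random variables with mean $\lambda\in(0,\infty)$. Let $\varepsilon>0$, $\delta\in(0,1)$, let $\delta_1,\delta_2,\ldots$ be positive numbers with $\sum_{\ell=1}^\infty\delta_\ell=\delta$, let $m_1<m_2<\cdots$ be an infinite sequence of positive integers with $\lim_{\ell\to\infty}\frac{\ln\delta_\ell}{m_\ell}=0$, and let $\mathcal N$ be a set of positive integers containing $\{m_1,m_2,\ldots\}$. Let $\overline{X}_n=\frac1n\sum_{i=1}^nX_i$. Let $\mathbf n$ be the smallest $n\in\mathcal N$ such that $\overline{X}_n>0$ and there exists a positive integer $\ell$ with $$M_{\mathrm P}\left(\frac{\overline{X}_n}{1+\varepsilon}\left(1+\frac{n\varepsilon}{n\vee m_\ell}\right),\ \frac{\overline{X}_n}{1+\varepsilon}\right)\le\frac1{m_\ell}\ln\frac{\delta_\ell}{2}.$$ Then such an $n$ exists with probability $1$ (i.e. the sampling process eventually stops almost surely), and $\Pr\{|\overline{X}_{\mathbf n}-\lambda|<\varepsilon\lambda\}\ge1-\delta$.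
   Context: $a\vee b$ denotes $\max(a,b)$. The function $M_{\mathrm P}$ is defined by: $M_{\mathrm P}(z,\theta)=z-\theta+z\ln\frac{\theta}{z}$ for $z>0$, $\theta>0$; $M_{\mathrm P}(0,\theta)=-\theta$ for $\theta>0$; $M_{\mathrm P}(z,\theta)=-\infty$ for $z\ge0$, $\theta\le0$. *)

(* Defs.v *)
From HB Require Import structures.
From mathcomp Require Import all_boot all_order all_algebra finmap.
From mathcomp Require Import all_classical all_reals all_analysis.

Set Implicit Arguments.
Unset Strict Implicit.
Unset Printing Implicit Defensive.
Import Order.TTheory GRing.Theory Num.Theory.
Import numFieldNormedType.Exports.
Local Open Scope classical_set_scope.
Local Open Scope ring_scope.

Definition independent_RVs (d : measure_display) (T : measurableType d)
    (R : realType) (P : probability T R) (I : choiceType)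
    (X : I -> {RV P >-> R}) : Prop :=
  forall (J : {fset I}) (B : I -> set R),
    (forall j, j \in J -> measurable (B j)) ->
    P (\bigcap_(j in [set` J]) (X j @^-1` B j)) =
    (\prod_(j <- J) P (X j @^-1` B j))%E.

(* The library's Poisson measure lives on [nat] (and its second argument is
   unused), so the law of a real-valued variable is compared with the image of
   that measure under the embedding of [nat] into [R]. *)
Definition poisson_RV (d : measure_display) (T : measurableType d)
    (R : realType) (P : probability T R) (lambda : R)
    (X : {RV P >-> R}) : Prop :=
  forall A : set R, measurable A ->
    distribution P X A = poisson_prob lambda 0 [set k : nat | A k%:R].

(* Only used for [0 <= z]; the value for [z < 0 < theta] is irrelevant. *)
Definition MP (R : realType) (z theta : R) : \bar R :=
  if theta <= 0 then -oo%E
  else if 0 < z then (z - theta + z * ln (theta / z))%:E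
  else (- theta)%:E.

(* Families indexed by 1, 2, ... are represented with indices 0, 1, ..., so
   [X i] stands for the (i+1)-st variable, and likewise for [delta_] and [m]. *)
Definition sample_mean (T : Type) (R : realType) (X : nat -> T -> R)
    (n : nat) (w : T) : R :=
  n%:R^-1 * \sum_(i < n) X i w.

Definition stop_condition (R : realType) (eps : R) (delta_ : nat -> R)
    (m : nat -> nat) (xbar : R) (n : nat) : Prop :=
  0 < xbar /\
  exists l : nat,
    (MP (xbar / (1 + eps) * (1 + n%:R * eps / (maxn n (m l))%:R))
        (xbar / (1 + eps))
     <= ((m l)%:R^-1 * ln (delta_ l / 2))%:E)%E.

Definition stopping_indices (T : Type) (R : realType) (X : nat -> T -> R)
    (eps : R) (delta_ : nat -> R) (m : nat -> nat) (N : set nat) (w : T) :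
    set nat :=
  [set n | N n /\ stop_condition eps delta_ m (sample_mean X n w) n].

Definition is_least (A : set nat) (n : nat) : Prop :=
  A n /\ forall k, A k -> (n <= k)%N.

(* Main.v *)
Require Import Defs.
From HB Require Import structures.
From mathcomp Require Import all_boot all_order all_algebra finmap.
From mathcomp Require Import all_classical all_reals all_analysis.
From mathcomp Require Import measurable_realfun.
From mathcomp Require Import ring lra.
Set Implicit Arguments.
Unset Strict Implicit.
Unset Printing Implicit Defensive.
Import Order.TTheory GRing.Theory Num.Theory.
Import numFieldNormedType.Exports.
Local Open Scope classical_set_scope.
Local Open Scope ring_scope.

(* Write [I y = y ln y - y + 1], so that the stopping rule for the index [l] at
   time [n] reads [ln (2 / delta_l) <= m_l * xbar / (1 + eps) * I (1 + u)] with
   [u = n eps / max n m_l].  If moreover [xbar >= (1 + eps) lambda], or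
   [xbar <= (1 - eps) lambda], then convexity of [I] shows that the walk
   [s S_n - n lambda (exp s - 1)] exceeds the level [ln (2 / delta_l)], for a
   slope [s] which depends neither on [n] nor on [xbar] ([upper_deviation_line],
   [lower_deviation_line]).  The exponential of this walk is a mean-one martingale, so the
   maximal inequality bounds the probability that it ever does so by
   [delta_l / 2], and a union bound over the two sides and over [l] gives
   [delta].  Stopping is almost sure because at [n = m_l] the rule holds as soon
   as [xbar >= lambda / 2] and [l] is large, and a Chernoff bound makes
   [xbar < lambda / 2] exponentially unlikely. *)

(** * Convexity and monotonicity of the Poisson rate function *)

(** The Cramér rate function of the Poisson law of mean 1, that is, the Legendre transform of
    [expR s - 1]. Its derivative is [ln], so the slope dual to [y] is [ln y]. *)
Definition poisson_rate (R : realType) (y : R) : R := y * ln y - y + 1.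

Lemma ln_lt_subr1 (R : realType) (t : R) : 0 < t -> t != 1 -> ln t < t - 1.
Proof.
move=> t0 t1; rewrite ltrBrDl -[ltRHS]lnK ?posrE//; apply: expR_gt1Dx.
by rewrite ln_eq0.
Qed.

(** Strict convexity: the gap between the two sides is [y * (x / y - 1 - ln (x / y))], positive
    because [ln t < t - 1] for [t != 1]. *)
Lemma poisson_rate_tangent_lt (R : realType) (x y : R) :
  0 < x -> 0 < y -> x != y ->
  poisson_rate x + ln x * (y - x) < poisson_rate y.
Proof.
move=> x0 y0 xy.
have : ln (x / y) < x / y - 1.
  apply: ln_lt_subr1; first exact: divr_gt0.
  by rewrite -(divff (lt0r_neq0 y0)) (inj_eq (divIf (lt0r_neq0 y0))).
rewrite ln_div ?posrE// -(ltr_pM2l y0).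
have -> : y * (x / y - 1) = x - y by field; rewrite gt_eqF.
rewrite /poisson_rate; lra.
Qed.

Lemma poisson_rate_tangent (R : realType) (x y : R) :
  0 < x -> 0 < y -> poisson_rate x + ln x * (y - x) <= poisson_rate y.
Proof.
move=> x0 y0; have [->|xy] := eqVneq x y; first by rewrite subrr mulr0 addr0.
by rewrite ltW// poisson_rate_tangent_lt.
Qed.

Lemma poisson_rate1 (R : realType) : poisson_rate (1 : R) = 0.
Proof. by rewrite /poisson_rate ln1 mulr0 sub0r addNr. Qed.

Lemma poisson_rate_ge0 (R : realType) (y : R) : 0 < y -> 0 <= poisson_rate y.
Proof.
move=> y0; have := poisson_rate_tangent (@ltr01 R) y0.
by rewrite poisson_rate1 ln1 mul0r addr0.
Qed.

Lemma poisson_rate_gt0 (R : realType) (y : R) :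
  0 < y -> y != 1 -> 0 < poisson_rate y.
Proof.
move=> y0 y1; have := poisson_rate_tangent_lt (@ltr01 R) y0.
by rewrite poisson_rate1 ln1 mul0r addr0; apply; rewrite eq_sym.
Qed.

(** By contraposition: if [y < x], the tangent at [y] has slope [ln y >= 0] and lies strictly below
    the graph at [x]. *)
Lemma poisson_rate_inc (R : realType) (x y : R) :
  1 <= x -> 1 <= y -> poisson_rate x <= poisson_rate y -> x <= y.
Proof.
move=> x1 y1; apply: contraTT; rewrite -!ltNge => yx.
have y0 : 0 < y by lra.
apply: le_lt_trans (poisson_rate_tangent_lt y0 _ _); [|lra|by rewrite lt_eqF].
by rewrite lerDl mulr_ge0 ?ln_ge0 ?subr_ge0// ltW.
Qed.

Lemma poisson_rate_dec (R : realType) (x y : R) :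
  0 < x -> 0 < y -> x <= 1 -> y <= 1 ->
  poisson_rate y <= poisson_rate x -> x <= y.
Proof.
move=> x0 y0 x1 y1; apply: contraTT; rewrite -!ltNge => yx.
apply: le_lt_trans (poisson_rate_tangent_lt x0 y0 _); last by rewrite gt_eqF.
by rewrite lerDl mulr_le0 ?ln_le0// subr_le0 ltW.
Qed.

(** The map [u |-> I (1 + u)] is convex and vanishes at 0. Concretely, the tangent at [1 + u]
    evaluated at [1 + t * u] exceeds the left side by [(t - 1) * (u - ln (1 + u))]. *)
Lemma poisson_rate_superlinear (R : realType) (t u : R) :
  1 <= t -> 0 <= u -> t * poisson_rate (1 + u) <= poisson_rate (1 + t * u).
Proof.
move=> t1 u0.
have tu0 : 0 <= t * u by rewrite mulr_ge0// (le_trans ler01).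
have := @poisson_rate_tangent R (1 + u) (1 + t * u).
move=> /(_ ltac:(lra) ltac:(lra)); apply: le_trans; rewrite -subr_ge0.
have -> : poisson_rate (1 + u) + ln (1 + u) * (1 + t * u - (1 + u)) -
    t * poisson_rate (1 + u) = (t - 1) * (u - ln (1 + u)).
  by rewrite /poisson_rate; ring.
by rewrite mulr_ge0 ?subr_ge0// le_ln1Dx//; lra.
Qed.

Lemma continuous_poisson_rate (R : realType) (y : R) :
  0 < y -> {for y, continuous (@poisson_rate R)}.
Proof.
move=> y0; apply: cvgD; last exact: cvg_cst.
apply: cvgB; last exact: cvg_id.
by apply: cvgM; [exact: cvg_id|exact: continuous_ln].
Qed.

Lemma is_derive_poisson_rate (R : realType) (y : R) :
  0 < y -> is_derive y 1 (@poisson_rate R) (ln y).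
Proof.
move=> y0; have dln := is_derive1_ln y0.
apply: is_derive_eq; rewrite /GRing.scale/= mulr1 divff ?gt_eqF//.
by rewrite addr0 addrAC subrr add0r.
Qed.

(** The difference [D] of the two sides vanishes at 0 and has derivative [- ln (1 - t ^ 2) >= 0];
    the mean value theorem concludes. This carries the stopping rule, stated above 1, over to lower
    deviations. *)
Lemma poisson_rate_le_reflect (R : realType) (x : R) :
  0 <= x -> x < 1 -> poisson_rate (1 + x) <= poisson_rate (1 - x).
Proof.
rewrite le_eqVlt => /predU1P[<- _|x0 x1]; first by rewrite addr0 subr0.
pose D (t : R) := poisson_rate (1 - t) - poisson_rate (1 + t).
have dD (t : R) : -1 < t -> t < 1 ->
    is_derive t 1 D (- (ln (1 - t) + ln (1 + t))).
  move=> t1 t2.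
  have p1 : 0 < 1 - t by lra.
  have p2 : 0 < 1 + t by lra.
  have d1 : is_derive t 1 (fun x : R => 1 - x) (- 1 : R).
    by apply: is_derive_eq; rewrite add0r mul1r.
  have d2 : is_derive t 1 (fun x : R => 1 + x) (1 : R).
    by apply: is_derive_eq; rewrite add0r mulr1.
  have c1 := @is_derive1_comp R (@poisson_rate R) (fun x : R => 1 - x) t _ _
    (is_derive_poisson_rate p1) d1.
  have c2 := @is_derive1_comp R (@poisson_rate R) (fun x : R => 1 + x) t _ _
    (is_derive_poisson_rate p2) d2.
  by apply: is_derive_eq; rewrite !mulr1 mulrN1 opprD.
have cD : {within `[0, x], continuous D}.
  apply: derivable_within_continuous => t; rewrite in_itv/= => /andP[t0 tx].
  by apply: ex_derive; apply: dD; lra.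
have dD0x (t : R) : t \in `]0, x[ -> is_derive t 1 D (- (ln (1 - t) + ln (1 + t))).
  by rewrite in_itv/= => /andP[t0 tx]; apply: dD; lra.
have [t] := MVT x0 dD0x cD.
rewrite in_itv/= => /andP[t0 tx].
have -> : D 0 = 0 by rewrite /D subr0 addr0 subrr.
rewrite subr0 -[_ <= _]subr_ge0 -/(D x) => -> .
rewrite subr0 mulr_ge0 ?(ltW x0)// oppr_ge0 -lnM ?posrE; [|lra..].
by apply: ln_le0; nra.
Qed.

Lemma poisson_rate_IVT (R : realType) (x y a : R) : 0 < x -> x <= y ->
  Num.min (poisson_rate x) (poisson_rate y) <= a
    <= Num.max (poisson_rate x) (poisson_rate y) ->
  exists2 z, x <= z <= y & poisson_rate z = a.
Proof.
move=> x0 xy /(IVT xy)[|z]; last by rewrite in_itv/=; exists z.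
apply: continuous_in_subspaceT => z; rewrite inE/= in_itv/= => /andP[xz _].
exact/continuous_poisson_rate/(lt_le_trans x0).
Qed.

(** * Stopping with a large error forces a walk of fixed slope above a fixed level *)

(** The slope is [ln y], where [y >= 1] solves [m * lambda * I y = a]. It must be chosen before [n]
    and [x], since the maximal inequality controls one walk at a time. *)
Lemma upper_deviation_line (R : realType) (lambda eps a : R) (m : nat) :
  0 < lambda -> 0 < eps -> 0 <= a -> (0 < m)%N ->
  exists s : R, forall (n : nat) (x : R), (0 < n)%N ->
    (1 + eps) * lambda <= x ->
    a <= m%:R * (x / (1 + eps) *
           poisson_rate (1 + n%:R * eps / (maxn n m)%:R)) ->
    a <= s * (n%:R * x) - n%:R * (lambda * (expR s - 1)).
Proof.
move=> lambda0 eps0 a0 m0.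
pose bad (nx : nat * R) := [/\ (0 < nx.1)%N, (1 + eps) * lambda <= nx.2 &
  a <= m%:R * (nx.2 / (1 + eps) *
           poisson_rate (1 + nx.1%:R * eps / (maxn nx.1 m)%:R))].
have mR : 0 < m%:R :> R by rewrite ltr0n.
(* Superlinearity with [t = x / ((1 + eps) * lambda)], which is at least 1, moves the factor [t]
   inside the rate function. *)
have badq n x : bad (n, x) -> a / (m%:R * lambda) <=
    poisson_rate (1 + x / (1 + eps) / lambda * (n%:R * eps / (maxn n m)%:R)).
  case=> /= n0 xge ale; apply: le_trans (poisson_rate_superlinear _ _).
  - rewrite ler_pdivrMr ?mulr_gt0//; apply: le_trans ale _.
    by rewrite le_eqVlt; apply/predU1P; left; field; lra.
  - by rewrite !ler_pdivlMr ?mul1r ?addr_gt0// mulrC.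
  - by rewrite divr_ge0// mulr_ge0// ltW.
(* Without a bad pair the claim is vacuous and any slope serves; otherwise one bad pair brackets the
   root [y] for the intermediate value theorem. *)
have [[[n1 x1] bad1]|nbad] := pselect (exists nx, bad nx); last first.
  by exists 0 => n x n0 xge ale; exfalso; apply: nbad; exists (n, x).
have := badq _ _ bad1; set q := (X in poisson_rate (1 + X)) => aq.
have q0 : 0 <= q.
  case: bad1 => /= _ xge _.
  have x10 : 0 <= x1 by apply: le_trans xge; rewrite mulr_ge0; lra.
  by rewrite /q !mulr_ge0// ?invr_ge0//; lra.
have [||y y1 ya] := @poisson_rate_IVT R 1 (1 + q) (a / (m%:R * lambda)) ltr01.
- lra.
- rewrite poisson_rate1 (min_idPl _) ?(max_idPr _) ?aq ?andbT
    ?divr_ge0 ?mulr_ge0//;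
    try exact: ltW; by apply: poisson_rate_ge0; lra.
have {y1} [y1 _] := andP y1; have y0 : 0 < y by lra.
exists (ln y) => n x n0 xge ale; rewrite lnK ?posrE//.
have nR : 0 < n%:R :> R by rewrite ltr0n.
have MR : 0 < (maxn n m)%:R :> R by rewrite ltr0n leq_max n0.
set M := (maxn n m)%:R in MR *.
have nM : n%:R <= M by rewrite ler_nat leq_maxl.
have mM : m%:R <= M by rewrite ler_nat leq_maxr.
pose v := n%:R / M.
have v1 : v <= 1 by rewrite ler_pdivrMr ?mul1r.
have v0 : 0 < v by exact: divr_gt0.
pose th := x / (1 + eps).
have xE : x = th * (1 + eps) by rewrite /th; field; lra.
have thl : lambda <= th by rewrite ler_pdivlMr 1?mulrC//; lra.
have := badq n x (And3 n0 xge ale); rewrite -ya -/M -/th.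
have -> : n%:R * eps / M = v * eps by rewrite mulrAC.
move=> /poisson_rate_inc.
have thv0 : 0 <= th / lambda * (v * eps).
  have th0 : 0 <= th by exact: le_trans (ltW lambda0) thl.
  exact: mulr_ge0 (divr_ge0 th0 (ltW lambda0)) (mulr_ge0 (ltW v0) (ltW eps0)).
move=> /(_ y1 ltac:(lra)).
rewrite -lerBlDl mulrAC ler_pdivlMr// => ythv.
have -> : a = m%:R * (lambda * poisson_rate y).
  by rewrite ya; field; rewrite !gt_eqF.
have -> : n%:R = M * v by rewrite /v; field; rewrite gt_eqF.
apply: (@le_trans _ _ (M * (lambda * poisson_rate y))).
  by rewrite ler_wpM2r// mulr_ge0 ?poisson_rate_ge0// ltW.
have -> : ln y * (M * v * x) - M * v * (lambda * (y - 1)) =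
  M * (v * (ln y * x - lambda * (y - 1))) by ring.
rewrite ler_pM2l// -subr_ge0 xE /poisson_rate.
(* Three nonnegative terms: they use [th >= lambda], the bound on [y - 1] just derived from [badq],
   and [v <= 1] with [ln y <= y - 1]. *)
have -> : v * (ln y * (th * (1 + eps)) - lambda * (y - 1)) -
    lambda * (y * ln y - y + 1) =
  v * ln y * (th - lambda) + ln y * (th * (v * eps) - (y - 1) * lambda) +
  lambda * ((1 - v) * (y - 1 - ln y)) by ring.
have lny0 : 0 <= ln y by exact: ln_ge0.
have lny1 : ln y <= y - 1.
  by have := @le_ln1Dx R (y - 1); rewrite addrCA subrr addr0; apply; lra.
clearbody v; by rewrite !addr_ge0// !mulr_ge0//; lra.
Qed.

(** Mirror image of the upper case, with [y <= 1] and slope [ln y <= 0]. Here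
    [x / (1 + eps) <= lambda] bounds the prefactor, and reflection moves [I (1 + v * eps)] to the
    left of 1, where [v = n / maxn n m]. *)
Lemma lower_deviation_line (R : realType) (lambda eps a : R) (m : nat) :
  0 < lambda -> 0 < eps -> 0 <= a -> (0 < m)%N ->
  exists s : R, forall (n : nat) (x : R), (0 < n)%N ->
    0 < x -> x <= (1 - eps) * lambda ->
    a <= m%:R * (x / (1 + eps) *
           poisson_rate (1 + n%:R * eps / (maxn n m)%:R)) ->
    a <= s * (n%:R * x) - n%:R * (lambda * (expR s - 1)).
Proof.
move=> lambda0 eps0 a0 m0.
pose bad (nx : nat * R) := [/\ (0 < nx.1)%N, 0 < nx.2,
  nx.2 <= (1 - eps) * lambda &
  a <= m%:R * (nx.2 / (1 + eps) *
           poisson_rate (1 + nx.1%:R * eps / (maxn nx.1 m)%:R))].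
have mR : 0 < m%:R :> R by rewrite ltr0n.
pose dev (n : nat) (x : R) := n%:R / (maxn n m)%:R * (1 - x / lambda).
have badq n x : bad (n, x) -> [/\ 0 <= dev n x, dev n x < 1 &
    a / (m%:R * lambda) <= poisson_rate (1 - dev n x)].
  case=> /= n0 x0 xle ale.
  have MR : 0 < (maxn n m)%:R :> R by rewrite ltr0n leq_max n0.
  have nR : 0 < n%:R :> R by rewrite ltr0n.
  have v0 : 0 < n%:R / (maxn n m)%:R :> R by exact: divr_gt0.
  have v1 : n%:R / (maxn n m)%:R <= 1 :> R.
    by rewrite ler_pdivrMr ?mul1r ?ler_nat ?leq_maxl.
  have ue : n%:R * eps / (maxn n m)%:R = n%:R / (maxn n m)%:R * eps :> R.
    by rewrite mulrAC.
  rewrite {}ue in ale; rewrite /dev.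
  set v := n%:R / (maxn n m)%:R in v0 v1 ale *.
  have xl0 : 0 < x / lambda by exact: divr_gt0.
  have xle' : x / lambda <= 1 - eps by rewrite ler_pdivrMr.
  have vd : v * eps <= v * (1 - x / lambda) by rewrite ler_pM2l//; lra.
  have ve0 : 0 < v * eps by exact: mulr_gt0.
  have d1 : v * (1 - x / lambda) < 1 by nra.
  split => //; first lra.
  apply: (@le_trans _ _ (poisson_rate (1 + v * eps))).
    rewrite ler_pdivrMr ?mulr_gt0//; apply: le_trans ale _.
    rewrite [leRHS]mulrC -[leRHS]mulrA ler_pM2l//.
    rewrite ler_wpM2r ?poisson_rate_ge0//; first lra.
    rewrite ler_pdivrMr; last lra.
    rewrite ler_pdivrMr// in xle'; nra.
  apply: (@le_trans _ _ (poisson_rate (1 - v * eps))).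
    by apply: poisson_rate_le_reflect; lra.
  (* Left of 1 the rate decreases, and [1 - v * (1 - x / lambda)] lies at or to the left of
     [1 - v * eps]. *)
  apply: le_trans (@poisson_rate_tangent R (1 - v * eps) _ _ _); [|lra..].
  by rewrite lerDl mulr_le0// ?ln_le0; lra.
have [[[n1 x1] bad1]|nbad] := pselect (exists nx, bad nx); last first.
  by exists 0 => n x n0 x0 xge ale; exfalso; apply: nbad; exists (n, x).
have [q0 q1 aq] := badq _ _ bad1.
(* Since [I] stays below 1 on the interval from 0 to 1, the root [y] need not exist in general; the
   bad pair guarantees it. *)
have [|||y /andP[yq y1] ya] :=
  @poisson_rate_IVT R (1 - dev n1 x1) 1 (a / (m%:R * lambda)).
- lra.
- lra.
- rewrite poisson_rate1 (min_idPr _) ?(max_idPl _) ?aq ?andbT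
    ?divr_ge0 ?mulr_ge0//;
    try exact: ltW; by apply: poisson_rate_ge0; lra.
have y0 : 0 < y by lra.
exists (ln y) => n x n0 x0 xle ale; rewrite lnK ?posrE//.
have [] := badq n x (And4 n0 x0 xle ale); rewrite -ya /dev.
have nR : 0 < n%:R :> R by rewrite ltr0n.
have MR : 0 < (maxn n m)%:R :> R by rewrite ltr0n leq_max n0.
set M := (maxn n m)%:R in MR *.
have nM : n%:R <= M by rewrite ler_nat leq_maxl.
have mM : m%:R <= M by rewrite ler_nat leq_maxr.
have v1 : n%:R / M <= 1 by rewrite ler_pdivrMr ?mul1r.
have v0 : 0 < n%:R / M by exact: divr_gt0.
have nE : n%:R = M * (n%:R / M) by field; rewrite gt_eqF.
set v := n%:R / M in v0 v1 nE *.
have xE : x = lambda * (x / lambda) by field; rewrite gt_eqF.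
set w := x / lambda in xE *.
move=> d0 d1 /poisson_rate_dec => 
  /(_ ltac:(lra) ltac:(lra) ltac:(lra) ltac:(lra)) yd.
have -> : a = m%:R * (lambda * poisson_rate y).
  by rewrite ya; field; rewrite !gt_eqF.
rewrite nE xE.
apply: (@le_trans _ _ (M * (lambda * poisson_rate y))).
  by rewrite ler_wpM2r// mulr_ge0 ?poisson_rate_ge0// ltW.
have -> : ln y * (M * v * (lambda * w)) - M * v * (lambda * (y - 1)) =
  M * (v * (ln y * (lambda * w) - lambda * (y - 1))) by ring.
rewrite ler_pM2l// -subr_ge0 /poisson_rate.
have -> : v * (ln y * (lambda * w) - lambda * (y - 1)) -
    lambda * (y * ln y - y + 1) =
  lambda * ((1 - v) * (y - 1 - ln y) + (v * (1 - w) - (1 - y)) * - ln y).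
  by ring.
have lny0 : ln y <= 0 by exact: ln_le0.
have lny1 : ln y <= y - 1.
  by have := @le_ln1Dx R (y - 1); rewrite addrCA subrr addr0; apply; lra.
by rewrite mulr_ge0 ?addr_ge0 ?mulr_ge0//; lra.
Qed.

(** * The stopping rule in terms of the rate function *)

Lemma MP_poisson_rate (R : realType) (theta u : R) : 0 < theta -> 0 <= u ->
  MP (theta * (1 + u)) theta = (- (theta * poisson_rate (1 + u)))%:E.
Proof.
move=> th0 u0; have u1 : 0 < 1 + u by lra.
rewrite /MP leNgt th0/= mulr_gt0// invfM mulrA divff ?gt_eqF// mul1r.
rewrite lnV ?posrE// /poisson_rate; congr (_%:E); ring.
Qed.

(** Positivity of [x] keeps [MP] in its logarithmic branch; multiplying by [- m l] reverses the
    inequality and turns [delta_ l / 2] into [2 / delta_ l]. *)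
Lemma stop_conditionE (R : realType) (eps : R) (delta_ : nat -> R)
    (m : nat -> nat) (x : R) (n : nat) :
  0 < eps -> (forall l, 0 < delta_ l) -> (forall l, (0 < m l)%N) ->
  stop_condition eps delta_ m x n <->
  0 < x /\ exists l, ln (2 / delta_ l) <= (m l)%:R * (x / (1 + eps) *
    poisson_rate (1 + n%:R * eps / (maxn n (m l))%:R)).
Proof.
move=> eps0 delta0 m0.
suff E l : 0 < x ->
    (MP (x / (1 + eps) * (1 + n%:R * eps / (maxn n (m l))%:R)) (x / (1 + eps))
       <= ((m l)%:R^-1 * ln (delta_ l / 2))%:E)%E =
    (ln (2 / delta_ l) <= (m l)%:R * (x / (1 + eps) *
      poisson_rate (1 + n%:R * eps / (maxn n (m l))%:R))).
  by split=> -[x0 [l]] => [|h]; [rewrite E//; split; [|exists l]|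
    split=> //; exists l; rewrite E].
move=> x0; rewrite MP_poisson_rate ?divr_gt0 ?divr_ge0 ?mulr_ge0//; try lra.
rewrite lee_fin -(invf_div (delta_ l)) lnV ?posrE ?divr_gt0//.
by rewrite [leRHS]mulrC ler_pdivlMr ?ltr0n// mulNr [in RHS]lerNl [in RHS]mulrC.
Qed.

(** * Poisson weights, exponential tilting and cylinder events *)

Lemma poisson_pmf_series (R : realType) (lambda : R) : 0 < lambda ->
  (\sum_(0 <= k <oo) (poisson_pmf lambda k)%:E = 1)%E.
Proof.
move=> lambda0; rewrite nneseries_esumT; last first.
  by move=> k; rewrite lee_fin poisson_pmf_ge0.
have := probability_setT (poisson_prob lambda 0).
by rewrite /= /poisson_prob lambda0.
Qed.

(** The exponential factor is the likelihood ratio of the Poisson law of mean [lambda * expR s] to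
    that of mean [lambda]. Summed over [k], this is the mean-one property of the martingale
    increments. *)
Lemma poisson_pmf_tilt (R : realType) (lambda s : R) (k : nat) : 0 < lambda ->
  poisson_pmf lambda k * expR (s * k%:R - lambda * (expR s - 1)) =
  poisson_pmf (lambda * expR s) k.
Proof.
move=> lambda0; rewrite /poisson_pmf lambda0 mulr_gt0 ?expR_gt0//.
have -> : s * k%:R - lambda * (expR s - 1) =
  k%:R * s + (lambda - lambda * expR s) by ring.
rewrite !expRD expRM_natl exprMn.
have -> (a b c d e f : R) : a * b * c * (d * (e * f)) = a * d * b * f * (c * e).
  by ring.
by rewrite -expRD addNr expR0 mulr1.
Qed.

Lemma poisson_RV_pmf (d : measure_display) (T : measurableType d)
    (R : realType) (P : probability T R) (lambda : R) (X : {RV P >-> R})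
    (k : nat) :
  0 < lambda -> poisson_RV lambda X ->
  P (X @^-1` [set k%:R]) = (poisson_pmf lambda k)%:E.
Proof.
move=> lambda0 /(_ [set k%:R] (measurable_set1 _)) /=.
rewrite /distribution/= /pushforward/= => ->; rewrite /poisson_prob lambda0.
rewrite (_ : [set i | _] = [set k]) ?esum_set1 ?lee_fin ?poisson_pmf_ge0//.
by apply/seteqP; split=> i /= => [/eqP|->//]; rewrite eqr_nat => /eqP.
Qed.

(** A real-valued Poisson variable is an integer only almost surely; this null event is set aside
    when conditioning on the next value. *)
Lemma poisson_RV_nat (d : measure_display) (T : measurableType d)
    (R : realType) (P : probability T R) (lambda : R) (X : {RV P >-> R}) :
  0 < lambda -> poisson_RV lambda X ->
  measurable (X @^-1` ~` range (fun k : nat => k%:R : R)) /\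
  P (X @^-1` ~` range (fun k : nat => k%:R : R)) = 0%E.
Proof.
move=> lambda0 X_poisson.
have mN : measurable (~` range (fun k : nat => k%:R : R)).
  apply: measurableC; rewrite (_ : range _ = \bigcup_k [set k%:R]).
    exact: bigcup_measurable.
  by apply/seteqP; split=> x [k _] => [<-|/= ->]; exists k.
split; first by rewrite -[X in measurable X]setTI; exact: measurable_funPT.
have := X_poisson _ mN; rewrite /distribution/= /pushforward/= => ->.
rewrite (_ : [set k | _] = set0) ?measure0//.
by apply/seteqP; split=> k //= h; apply: h; exists k.
Qed.

(** Cylinders play the part of the filtration: as the values are almost surely integers,
    conditioning on the past is conditioning on countably many such events. *)
Definition cylinder (T : Type) (R : realType) (X : nat -> T -> R) (j : nat)
    (x : nat -> nat) : set T :=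
  [set w | forall i, (i < j)%N -> X i w = (x i)%:R].

Lemma cylinder_bigcap (T : Type) (R : realType) (X : nat -> T -> R) (j : nat)
    (x : nat -> nat) :
  cylinder X j x =
  \bigcap_(i in [set` [fset i in iota 0 j]%fset]) (X i @^-1` [set (x i)%:R]).
Proof.
by apply/seteqP; split=> w h i; have := h i; rewrite /= !inE mem_iota.
Qed.

Lemma measurable_cylinder (d : measure_display) (T : measurableType d)
    (R : realType) (P : probability T R) (X : nat -> {RV P >-> R}) (j : nat)
    (x : nat -> nat) : measurable (cylinder X j x).
Proof.
by rewrite cylinder_bigcap; apply: fin_bigcap_measurable => // i _.
Qed.

Lemma probability_cylinder (d : measure_display) (T : measurableType d)
    (R : realType) (P : probability T R) (X : nat -> {RV P >-> R})
    (lambda : R) (j : nat) (x : nat -> nat) : 0 < lambda ->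
  independent_RVs X -> (forall i, poisson_RV lambda (X i)) ->
  P (cylinder X j x) = (\prod_(i < j) poisson_pmf lambda (x i))%:E.
Proof.
move=> lambda0 X_indep X_poisson; rewrite cylinder_bigcap X_indep//.
rewrite (eq_bigr (fun i => (poisson_pmf lambda (x i))%:E)); last first.
  by move=> i _; exact: poisson_RV_pmf.
rewrite prodEFin; congr (_%:E).
rewrite -(big_mkord xpredT (fun i => poisson_pmf lambda (x i))).
apply: perm_big; apply: uniq_perm; rewrite ?fset_uniq ?iota_uniq//.
by move=> i; rewrite !inE /index_iota subn0.
Qed.

(** * The maximal inequality for the exponential martingale *)

(** The walk restarts from 0 at time [j] with horizon [n], the form needed for induction on [n]. The
    empty sum [k = 0] counts, so every level [y <= 0] is crossed at once. *)
Definition crossing (T : Type) (R : realType) (X : nat -> T -> R) (s psi : R)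
    (j n : nat) (y : R) : set T :=
  [set w | exists2 k, (k <= n)%N &
     y <= \sum_(j <= i < j + k) (s * X i w - psi)].

Lemma measurable_crossing (d : measure_display) (T : measurableType d)
    (R : realType) (P : probability T R) (X : nat -> {RV P >-> R})
    (s psi : R) (j n : nat) (y : R) : measurable (crossing X s psi j n y).
Proof.
pose S k w := \sum_(j <= i < j + k) (s * X i w - psi).
rewrite (_ : crossing _ _ _ _ _ _ =
    \bigcup_(k in `I_n.+1) (S k @^-1` `[y, +oo[)); last first.
  apply/seteqP; split=> w [k kn /=] h; exists k => //=.
    by rewrite in_itv/= h.
  by move: h; rewrite in_itv/= andbT.
apply: bigcup_measurable => k _.
rewrite -[X in measurable X]setTI.
suff : measurable_fun setT (S k) by apply.
apply: measurable_sum => i; apply: measurable_funB => //.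
by apply: measurable_funM => //; exact: measurable_funPT.
Qed.

(* Conditionally on the first [j] values, the walk started at time [j] crosses
   [y] with probability at most [expR (- y)]: condition on the next value and
   use that the exponential tilt of a Poisson law is again a Poisson law. *)
Lemma probability_crossing_cylinder (d : measure_display)
    (T : measurableType d) (R : realType) (P : probability T R)
    (X : nat -> {RV P >-> R}) (lambda s : R) (n j : nat) (y : R)
    (x : nat -> nat) : 0 < lambda ->
  independent_RVs X -> (forall i, poisson_RV lambda (X i)) ->
  (P (cylinder X j x `&` crossing X s (lambda * (expR s - 1)) j n y) <=
   (\prod_(i < j) poisson_pmf lambda (x i) * expR (- y))%:E)%E.
Proof.
move=> lambda0 X_indep X_poisson; set psi := lambda * _.
have pmf_ge0 (z : nat -> nat) i : 0 <= \prod_(k < i) poisson_pmf lambda (z k).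
  by apply: prodr_ge0 => k _; exact: poisson_pmf_ge0.
have mA i z k b : measurable (cylinder X i z `&` crossing X s psi i k b).
  by apply: measurableI;
    [exact: measurable_cylinder|exact: measurable_crossing].
elim: n j y x => [|n IHn] j y x; have [y0|y0] := leP y 0.
(* For [y <= 0], at any horizon, [expR (- y) >= 1] and the probability of the cylinder alone
   suffices. *)
1,3: apply: (@le_trans _ _ (P (cylinder X j x)));
  [by apply: le_measure; rewrite ?inE//; exact: measurable_cylinder|];
  rewrite (probability_cylinder _ _ lambda0)// lee_fin ler_peMr//;
  by rewrite -expR0 ler_expR oppr_ge0.
  (* With horizon 0 and [y > 0] only the empty sum is available, and it stays below [y]. *)
  rewrite (_ : _ `&` _ = set0).
    by rewrite measure0 lee_fin mulr_ge0 ?expR_ge0.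
  apply/seteqP; split=> // w [_ [k]]; rewrite leqn0 => /eqP ->.
  by rewrite addn0 big_geq// leNgt y0.
(* First-step decomposition: [B k] extends the cylinder by the value [k] at time [j] and lowers the
   level by the first increment. The null event of non-integer values is then joined to every
   [B k]. *)
pose upd k i := if i == j then k else x i.
pose B k := cylinder X j.+1 (upd k) `&`
  crossing X s psi j.+1 n (y - (s * k%:R - psi)).
have [mN PN] := poisson_RV_nat lambda0 (X_poisson j).
set N := _ @^-1` _ in mN PN.
have sub : cylinder X j x `&` crossing X s psi j n.+1 y `<=`
    \bigcup_k (B k `|` N).
  move=> w [cw [k kn yk]].
  have [[i _ Xi]|Nw] := pselect (range (fun k : nat => k%:R : R) (X j w)); last first.
    by exists 0%N => //; right.
  exists i => //; left; split.
    move=> h; rewrite ltnS leq_eqVlt /upd => /predU1P[->|hj].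
      by rewrite eqxx.
    by rewrite ltn_eqF// cw.
  case: k kn yk => [|k] kn; first by rewrite addn0 big_geq// leNgt y0.
  rewrite big_ltn ?addnS ?ltnS ?leq_addr// -Xi => yk.
  by exists k => //; rewrite lerBlDl addSn.
have mBN k : measurable (B k `|` N) by apply: measurableU => //; exact: mA.
have := measure_sigma_subadditive P mBN (mA _ _ _ _) sub.
move=> /le_trans; apply.
pose c := \prod_(i < j) poisson_pmf lambda (x i) * expR (- y).
(* The induction hypothesis for [B k], once tilted, reads [c] times the Poisson weight of mean
   [lambda * expR s] at [k]; these weights sum to 1. *)
apply: (@le_trans _ _
  (\sum_(0 <= k <oo) (c%:E * (poisson_pmf (lambda * expR s) k)%:E))%E).
  apply: lee_nneseries => // k _.
  have mB : measurable (B k) by exact: mA.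
  apply: (@le_trans _ _ (P (B k) + P N)%E); first exact: measureU2.
  rewrite PN adde0; apply: le_trans (IHn _ _ _) _.
  rewrite -EFinM lee_fin big_ord_recr/= /upd eqxx.
  under eq_bigr => i _ do rewrite ltn_eqF ?ltn_ord//.
  by rewrite opprB addrC expRD -poisson_pmf_tilt// -/psi mulrACA.
rewrite nneseriesZl; last by move=> k _; rewrite lee_fin poisson_pmf_ge0.
by rewrite poisson_pmf_series ?mule1 ?mulr_gt0 ?expR_gt0.
Qed.

(** Ville's inequality. The event is the increasing union of the finite-horizon crossings from time
    0, where the cylinder is the whole space, and continuity from below passes to the limit. *)
Lemma poisson_maximal_inequality (d : measure_display)
    (T : measurableType d) (R : realType) (P : probability T R)
    (X : nat -> {RV P >-> R}) (lambda s a : R) : 0 < lambda ->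
  independent_RVs X -> (forall i, poisson_RV lambda (X i)) ->
  let E := [set w | exists n : nat,
    a <= s * (\sum_(i < n) X i w) - n%:R * (lambda * (expR s - 1))] in
  measurable E /\ (P E <= (expR (- a))%:E)%E.
Proof.
move=> lambda0 X_indep X_poisson E; set psi := lambda * _ in E *.
have EE : E = \bigcup_n crossing X s psi 0 n a.
  have sumE n w : \sum_(0 <= i < 0 + n) (s * X i w - psi) =
      s * (\sum_(i < n) X i w) - n%:R * psi.
    rewrite add0n big_mkord big_split/= -mulr_sumr; congr (_ + _).
    by rewrite sumr_const card_ord mulNrn mulr_natl.
  apply/seteqP; split=> [w [n h]|w [n _ [k _]]].
    by exists n => //; exists n; rewrite ?sumE.
  by rewrite sumE => h; exists k.
have mC n : measurable (crossing X s psi 0 n a) by exact: measurable_crossing.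
have mE : measurable E by rewrite EE; exact: bigcup_measurable.
split=> //; rewrite EE in mE *.
have /cvg_lim <- // : P \o (fun n => crossing X s psi 0 n a) @ \oo -->
    P (\bigcup_n crossing X s psi 0 n a).
  apply: nondecreasing_cvg_mu => // k n kn; apply/subsetPset => w [i ik h].
  by exists i => //; exact: leq_trans kn.
apply: lime_le.
  apply: ereal_nondecreasing_is_cvgn => k n kn.
  apply: le_measure; rewrite ?inE// => w [i ik h].
  by exists i => //; exact: leq_trans kn.
apply: nearW => n /=.
have := @probability_crossing_cylinder _ _ _ P X lambda s n 0 a (fun=> 0%N)
  lambda0 X_indep X_poisson.
rewrite big_ord0 mul1r; congr (P _ <= _)%E.
by apply/seteqP; split=> [w []|].
Qed.

(** * Sample means: measurability, deviations at stopping, and the lower tail *)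

Lemma sample_meanK (T : Type) (R : realType) (X : nat -> T -> R) (n : nat)
    (w : T) : (0 < n)%N -> n%:R * sample_mean X n w = \sum_(i < n) X i w.
Proof. by move=> n0; rewrite /sample_mean mulVKf// pnatr_eq0 -lt0n. Qed.

Lemma measurable_sample_mean (d : measure_display) (T : measurableType d)
    (R : realType) (P : probability T R) (X : nat -> {RV P >-> R}) (n : nat)
    (A : set R) :
  measurable A -> measurable [set w | A (sample_mean X n w)].
Proof.
move=> mA; rewrite -[X in measurable X]setTI.
suff : measurable_fun setT (sample_mean X n) by apply.
apply: measurable_funM => //; apply: measurable_sum => i.
exact: measurable_funPT.
Qed.

(* The rule is monotone in the sample mean, so its stopping region is an
   interval. *)
Lemma measurable_stop_condition (R : realType) (eps : R) (delta_ : nat -> R)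
    (m : nat -> nat) (n : nat) :
  0 < eps -> (forall l, 0 < delta_ l) -> (forall l, (0 < m l)%N) ->
  measurable [set x | stop_condition eps delta_ m x n].
Proof.
move=> eps0 delta0 m0; apply: is_interval_measurable => x y + _ z /andP[xz _].
rewrite /= !stop_conditionE// => -[x0 [l h]]; split.
  exact: lt_le_trans xz.
exists l; apply: le_trans h _; rewrite ler_wpM2l// ler_wpM2r//.
  rewrite poisson_rate_ge0// ltr_pwDl// divr_ge0// mulr_ge0//; exact: ltW.
by rewrite ler_pM2r// invr_gt0 addr_gt0.
Qed.

(** The event [B] is independent of [n], so a union over [l] alone will cover all stopping times. It
    joins one upper and one lower crossing event, each of probability at most
    [expR (- ln (2 / dl)) = dl / 2]. *)
Lemma stop_deviation_bound (d : measure_display) (T : measurableType d)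
    (R : realType) (P : probability T R) (X : nat -> {RV P >-> R})
    (lambda eps dl : R) (m : nat) : 0 < lambda ->
  independent_RVs X -> (forall i, poisson_RV lambda (X i)) ->
  0 < eps -> 0 < dl -> dl < 1 -> (0 < m)%N ->
  exists B : set T, [/\ measurable B, (P B <= dl%:E)%E &
    forall (n : nat) (w : T), (0 < n)%N -> 0 < sample_mean X n w ->
      ln (2 / dl) <= m%:R * (sample_mean X n w / (1 + eps) *
        poisson_rate (1 + n%:R * eps / (maxn n m)%:R)) ->
      eps * lambda <= `|sample_mean X n w - lambda| -> B w].
Proof.
move=> lambda0 X_indep X_poisson eps0 dl0 dl1 m0.
have q0 : 0 < 2 / dl by exact: divr_gt0.
have a0 : 0 <= ln (2 / dl) by rewrite ln_ge0// ler_pdivlMr//; lra.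
have [s hs] := upper_deviation_line lambda0 eps0 a0 m0.
have [t ht] := lower_deviation_line lambda0 eps0 a0 m0.
have [mU PU] := poisson_maximal_inequality s (ln (2 / dl))
  lambda0 X_indep X_poisson.
have [mD PD] := poisson_maximal_inequality t (ln (2 / dl))
  lambda0 X_indep X_poisson.
set U := [set w | _] in mU PU; set D := [set w | _] in mD PD.
exists (U `|` D); split; first exact: measurableU.
  apply: (@le_trans _ _ (P U + P D)%E); first exact: measureU2.
  apply: le_trans (leeD PU PD) _.
  rewrite -EFinD lee_fin expRN lnK ?posrE// invf_div; lra.
move=> n w n0 x0 hstop; rewrite ler_normr => /orP[hx|hx].
  by left; exists n; rewrite -(sample_meanK X)//; apply: hs => //; lra.
by right; exists n; rewrite -(sample_meanK X)//; apply: ht => //; lra.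
Qed.

(** Chernoff bound with slope -1, read off from the maximal inequality at the single time [n]. The
    exponent is useful because [expR 1 > 2]. *)
Lemma probability_sample_mean_small (d : measure_display)
    (T : measurableType d) (R : realType) (P : probability T R)
    (X : nat -> {RV P >-> R}) (lambda : R) (n : nat) : 0 < lambda ->
  independent_RVs X -> (forall i, poisson_RV lambda (X i)) -> (0 < n)%N ->
  (P [set w | (sample_mean X n w < lambda / 2)%R] <=
   (expR (- (n%:R * (lambda * (1 / 2 - expR (-1))))))%:E)%E.
Proof.
move=> lambda0 X_indep X_poisson n0.
have [mE] := poisson_maximal_inequality (-1)
  (n%:R * (lambda * (1 / 2 - expR (-1)))) lambda0 X_indep X_poisson.
apply: le_trans; apply: le_measure; rewrite ?inE//.
  rewrite (_ : [set w | _] =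
      [set w | `]-oo, lambda / 2[%classic (sample_mean X n w)]).
    exact: measurable_sample_mean.
  by apply/seteqP; split=> w /=; rewrite in_itv.
move=> w /= hw; exists n; rewrite -(sample_meanK X)//.
rewrite -subr_ge0.
have -> (A : R) : -1 * (n%:R * A) - n%:R * (lambda * (expR (-1) - 1)) -
  n%:R * (lambda * (1 / 2 - expR (-1))) = n%:R * (lambda / 2 - A) by field.
by rewrite mulr_ge0// subr_ge0 ltW.
Qed.

(** * Almost sure stopping, then the union bound over the indices [l] *)

Theorem mainTheorem6 (d : measure_display) (T : measurableType d)
    (R : realType) (P : probability T R) (X : nat -> {RV P >-> R})
    (lambda eps delta : R) (delta_ : nat -> R) (m : nat -> nat)
    (N : set nat)
    (lambda_gt0 : 0 < lambda)
    (X_indep : independent_RVs X)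
    (X_poisson : forall i, poisson_RV lambda (X i))
    (eps_gt0 : 0 < eps)
    (delta_gt0 : 0 < delta) (delta_lt1 : delta < 1)
    (delta__gt0 : forall l, 0 < delta_ l)
    (delta__sum : series delta_ @ \oo --> delta)
    (m_gt0 : forall l, (0 < m l)%N)
    (m_incr : forall k l, (k < l)%N -> (m k < m l)%N)
    (ln_delta_m : (fun l => ln (delta_ l) / (m l)%:R) @ \oo --> (0 : R))
    (N_gt0 : forall n, N n -> (0 < n)%N)
    (m_sub_N : forall l, N (m l)) :
  P [set w | exists n, stopping_indices X eps delta_ m N w n] = 1%E /\
  (P [set w | exists n, is_least (stopping_indices X eps delta_ m N w) n /\
                (`|sample_mean X n w - lambda| < eps * lambda)%R]
   >= (1 - delta)%:E)%E.
Proof.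
pose A n := [set w | stopping_indices X eps delta_ m N w n].
have mA n : measurable (A n).
  have [Nn|Nn] := pselect (N n); last first.
    by rewrite (_ : A n = set0)//; apply/seteqP; split=> w // -[].
  rewrite (_ : A n = [set w | [set x | stop_condition eps delta_ m x n]
                               (sample_mean X n w)]).
    by apply: measurable_sample_mean; exact: measurable_stop_condition.
  by apply/seteqP; split=> w => [[]|].
pose E := [set w | exists n, A n w].
have mE : measurable E.
  rewrite (_ : E = \bigcup_n A n); first exact: bigcup_measurable.
  by apply/seteqP; split=> [w [n h]|w [n _ h]]; exists n.
have delta__sumE : (\sum_(0 <= l <oo) (delta_ l)%:E = delta%:E)%E.
  rewrite -(cvg_lim _ delta__sum)// -EFin_lim; last first.
    by apply/cvg_ex; exists delta.
  by apply/congr_lim/funext => n /=; rewrite /series/= sumEFin.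
have delta__lt1 l : delta_ l < 1.
  apply: le_lt_trans delta_lt1; rewrite -lee_fin -delta__sumE.
  have := @nneseries_lim_ge R (fun l => (delta_ l)%:E) xpredT 0 l.+1.
  move=> /(_ (fun n _ _ => ltac:(by rewrite lee_fin ltW)))/(le_trans _); apply.
  rewrite big_nat_recr//= leeDr// sumEFin lee_fin.
  by apply: sumr_ge0 => i _; exact: ltW.
have m_ge l : (l <= m l)%N.
  by elim: l => // l /leq_ltn_trans; apply; exact: m_incr.
have kappa0 : 0 < lambda * (1 / 2 - expR (-1)).
  rewrite mulr_gt0// subr_gt0 expRN div1r ltf_pV2 ?posrE ?expR_gt0//.
  by have := @expR_gt1Dx R 1; rewrite oner_eq0; apply.
set kappa := lambda * _ in kappa0.
have r0 : 0 < lambda / 2 / (1 + eps) * poisson_rate (1 + eps).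
  apply: mulr_gt0; first by rewrite !divr_gt0// addr_gt0.
  by rewrite poisson_rate_gt0 ?addr_gt0// gt_eqF// ltrDl.
have PE : P E = 1%E.
  suff : P (~` E) = 0%E.
    move=> E0; rewrite -[E]setCK probability_setC ?E0 ?sube0//.
    exact: measurableC.
  apply/eqP; rewrite eq_le measure_ge0 andbT; apply/lee_addgt0Pr => e e0.
  rewrite add0e.
  (* The rate available at [m l] is split in two: one half dominates [- ln (delta_ l) / m l], the
     other absorbs [ln 2] once [l] is large, since [l <= m l]. *)
  have lnd : \forall l \near \oo, - (ln (delta_ l) / (m l)%:R) <
      lambda / 2 / (1 + eps) * poisson_rate (1 + eps) / 2.
    near do rewrite ltrNl.
    move/cvgr_gt : ln_delta_m; apply; rewrite oppr_lt0; exact: divr_gt0.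
  near \oo => l.
  have mR : 0 < (m l)%:R :> R by rewrite ltr0n.
  have lm : l%:R <= (m l)%:R :> R by rewrite ler_nat.
  have stop_l : ln (2 / delta_ l) <= (m l)%:R *
      (lambda / 2 / (1 + eps) * poisson_rate (1 + eps)).
    rewrite ln_div ?posrE//.
    have h1 : - (ln (delta_ l) / (m l)%:R) <
      lambda / 2 / (1 + eps) * poisson_rate (1 + eps) / 2 by near: l.
    have h2 : ln 2 / (lambda / 2 / (1 + eps) * poisson_rate (1 + eps) / 2) <=
        l%:R.
      by near: l; exact: nbhs_infty_ger.
    rewrite -mulNr ltr_pdivrMr// in h1.
    rewrite ler_pdivrMr ?divr_gt0// in h2.
    set r := lambda / 2 / (1 + eps) * poisson_rate (1 + eps) in r0 h1 h2 *.
    have : l%:R * (r / 2) <= (m l)%:R * (r / 2) by rewrite ler_pM2r// divr_gt0.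
    by lra.
  (* A single large [l] suffices: not stopping at time [m l] forces the mean there below
     [lambda / 2]. *)
  apply: (@le_trans _ _ (P [set w | (sample_mean X (m l) w < lambda / 2)%R])).
    apply: le_measure; rewrite ?inE; first exact: measurableC.
      rewrite (_ : [set w | _] =
          [set w | `]-oo, lambda / 2[%classic (sample_mean X (m l) w)]).
        exact: measurable_sample_mean.
      by apply/seteqP; split=> w /=; rewrite in_itv.
    move=> w nE /=; rewrite ltNge; apply/negP => xge; apply: nE.
    exists (m l); split=> //; apply/stop_conditionE => //.
    split; first by apply: lt_le_trans xge; exact: divr_gt0.
    (* At [n = m l] the maximum is [n] itself, so [u = eps]. *)
    exists l; rewrite maxnn [_ * eps]mulrC mulfK ?gt_eqF//.
    apply: le_trans stop_l _; rewrite ler_pM2l// ler_wpM2r//.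
      by rewrite poisson_rate_ge0// addr_gt0.
    by rewrite ler_pM2r// invr_gt0 addr_gt0.
  apply: le_trans (probability_sample_mean_small lambda_gt0 X_indep X_poisson
    (m_gt0 l)) _.
  (* The crude bound [expR t >= 1 + t] is enough: it exceeds [e^-1] as soon as
     [m l * kappa >= e^-1]. *)
  rewrite -/kappa lee_fin expRN -[leRHS]invrK.
  rewrite lef_pV2 ?posrE ?expR_gt0 ?invr_gt0//.
  apply: le_trans (expR_ge1Dx _); apply: (@le_trans _ _ ((m l)%:R * kappa)).
    rewrite -ler_pdivrMr//; apply: le_trans lm.
    by near: l; exact: nbhs_infty_ger.
  by rewrite lerDr.
split=> //.
have /choice[B hB] l := stop_deviation_bound lambda_gt0 X_indep X_poisson
  eps_gt0 (delta__gt0 l) (delta__lt1 l) (m_gt0 l).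
have mB l : measurable (B l) by case: (hB l).
pose BB := \bigcup_l B l.
have mBB : measurable BB by exact: bigcup_measurable.
have PBB : (P BB <= delta%:E)%E.
  have := measure_sigma_subadditive P mB mBB (@subset_refl _ BB).
  move=> /le_trans; apply; rewrite -delta__sumE.
  by apply: lee_nneseries => // l _; case: (hB l).
pose G := [set w | exists n, is_least (stopping_indices X eps delta_ m N w) n /\
                (`|sample_mean X n w - lambda| < eps * lambda)%R].
have mG : measurable G.
  rewrite (_ : G = \bigcup_n ((A n `&` \bigcap_(k in `I_n) ~` A k) `&`
      [set w | `]lambda - eps * lambda, lambda + eps * lambda[%classic
                (sample_mean X n w)])).
    apply: bigcup_measurable => n _; apply: measurableI; last first.
      exact: measurable_sample_mean.
    apply: measurableI => //; apply: fin_bigcap_measurable => // k _.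
    exact: measurableC.
  apply/seteqP; split=> w [n].
    move=> [[An least]]; rewrite ltr_distl => h; exists n => //; split.
      by split=> // k /= kn /least; rewrite leqNgt kn.
    by rewrite /= in_itv.
  move=> _ [[An least]] /=; rewrite in_itv/= -ltr_distl => h.
  exists n; split=> //; split=> // k Ak; rewrite leqNgt; apply/negP => kn.
  exact: least Ak.
(* Off [BB] every admissible stopping index gives an accurate mean, in particular the least one. *)
have EG : E `&` ~` BB `<=` G.
  move=> w [[n0 An0] nB].
  have ex : exists n, `[< A n w >] by exists n0; apply/asboolP.
  case: (ex_minnP ex) => n /asboolP An least; exists n; split.
    by split=> // k Ak; apply: least; apply/asboolP.
  rewrite ltNge; apply/negP => far; apply: nB.
  case: An => Nn /stop_conditionE[]// x0 [l hl].
  by exists l => //; case: (hB l) => _ _ /(_ n w); apply=> //; exact: N_gt0.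
have mEB : measurable (E `&` ~` BB).
  by apply: measurableI => //; exact: measurableC.
apply: (@le_trans _ _ (P (E `&` ~` BB))); last first.
  by apply: le_measure; rewrite ?inE.
have : (P E <= P (E `&` ~` BB) + P BB)%E.
  apply: (@le_trans _ _ (P ((E `&` ~` BB) `|` BB))); last exact: measureU2.
  apply: le_measure; rewrite ?inE//; first exact: measurableU.
  by move=> w Ew; have [?|?] := pselect (BB w); [right|left].
rewrite PE => h; rewrite EFinB leeBlDr//.
by apply: le_trans h _; rewrite leeD2l.
Unshelve. all: by end_near. Qed.
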